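(* Let $k\ge2$ and let $(G(\bar{x},y,z),t(\bar{x}))$ and $(H(\bar{x},v,w),s(\bar{x}))$ be two $(k,2)$-games. Then $\mathrm{PV}_k\vdash\exists y\le t(\bar{x})\forall z\le t(\bar{x})\,G(\bar{x},y,z)\to\exists v\le s(\bar{x})\forall w\le s(\bar{x})\,H(\bar{x},v,w)$ if and only if there exists a $(k,2)$-reduction from $(H,s)$ to $(G,t)$.
   Context: For $k\ge1$, $\mathrm{PV}_k$ is the universal theory over a language $\mathcal{L}_{\mathrm{PV}_k}$ that has a term for every function in the $k$-th level $\Box^p_k$ of the polynomial hierarchy ($\mathrm{PV}_1$ is Cook's theory $\mathrm{PV}$ over $\mathcal{L}_{\mathrm{PV}}$); $\mathcal{L}_{\mathrm{PV}_k}$ contains $\mathcal{L}_{\mathrm{PV}}$ (in particular pairing and projections), terms for characteristic functions of $\hat{\Sigma}^b_k$-formulas, and is closed under definition by cases. For $k\ge2$, a $(k,2)$-game is a pair $(G(\bar{x},y,z),t(\bar{x}))$ with $G$ a quantifier-free $\mathcal{L}_{\mathrm{PV}_k}$-formula and $t$ an $\mathcal{L}_{\mathrm{PV}_k}$-term (first player plays $y\le t(\bar{x})$, second player plays $z\le t(\bar{x})$, first player wins iff $G$ holds). A $(k,2)$-reduction from $(H(\bar{x},v,w),s(\bar{x}))$ to $(G(\bar{x},y,z),t(\bar{x}))$ is a finite sequence of $\mathcal{L}_{\mathrm{PV}_k}$-terms $f_0(\bar{x},y),f_1(\bar{x},y,w_0),\dots,f_m(\bar{x},y,w_0,\dots,w_{m-1})$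 together with an $\mathcal{L}_{\mathrm{PV}_k}$-term $g(\bar{x},y,w_0,\dots,w_m)$ such that $\mathrm{PV}_k$ proves: $\forall\bar{w}\le s(\bar{x})\forall y\le t(\bar{x})[f_i(\bar{x},y,w_0,\dots,w_{i-1})\le s(\bar{x})]$ for each $0\le i\le m$; $\forall\bar{w}\le s(\bar{x})\forall y\le t(\bar{x})[g(\bar{x},y,w_0,\dots,w_m)\le t(\bar{x})]$; and $\forall\bar{w}\le s(\bar{x})\forall y\le t(\bar{x})[G(\bar{x},y,g(\bar{x},y,w_0,\dots,w_m))\to\bigvee_{i=0}^mH(\bar{x},f_i(\bar{x},y,w_0,\dots,w_{i-1}),w_i)]$. *)

(* Defs.v *)
From mathcomp Require Import all_boot.
From Stdlib Require List.

Set Implicit Arguments.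
Unset Strict Implicit.
Unset Printing Implicit Defensive.

(* Classical first-order logic with equality and one further binary predicate
   [<=], over function symbols F indexed by arity.  Variables are numbers and
   [All] is a de Bruijn binder; [allv]/[exv] below bind a named variable. *)

Inductive term (F : nat -> Type) : Type :=
| Var of nat
| App n (f : F n) (a : 'I_n -> term F).
Arguments Var {F}.

Fixpoint tsubst F (s : nat -> term F) (t : term F) : term F :=
  match t with
  | Var i => s i
  | App n f a => App f (fun i => tsubst s (a i))
  end.

Fixpoint tvars_lt F (N : nat) (t : term F) : Prop :=
  match t with
  | Var i => i < N
  | App n f a => forall i, tvars_lt N (a i)
  end.

Inductive form (F : nat -> Type) : Type :=
| Bot
| Eq of term F & term F
| Le of term F & term F
| Imp of form F & form F
| All of form F.
Arguments Bot {F}.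

Definition Not F (A : form F) := Imp A Bot.
Definition And F (A B : form F) := Not (Imp A (Not B)).
Definition Or F (A B : form F) := Imp (Not A) B.
Definition Iff F (A B : form F) := And (Imp A B) (Imp B A).
Definition Ex F (A : form F) := Not (All (Not A)).

Declare Scope fol_scope.
Delimit Scope fol_scope with fol.
Notation "t =f u" := (Eq t u) (at level 70) : fol_scope.
Notation "t <=f u" := (Le t u) (at level 70) : fol_scope.
Notation "t <>f u" := (Not (Eq t u)) (at level 70) : fol_scope.
Notation "A &f B" := (And A B) (at level 80, right associativity) : fol_scope.
Notation "A |f B" := (Or A B) (at level 85, right associativity) : fol_scope.
Notation "A ->f B" := (Imp A B) (at level 90, right associativity) : fol_scope.
Notation "A <->f B" := (Iff A B) (at level 95) : fol_scope.
Local Open Scope fol_scope.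

Fixpoint qf F (A : form F) : Prop :=
  match A with
  | Imp B C => qf B /\ qf C
  | All _ => False
  | _ => True
  end.

Fixpoint fvars_lt F (N : nat) (A : form F) : Prop :=
  match A with
  | Bot => True
  | Eq t u => tvars_lt N t /\ tvars_lt N u
  | Le t u => tvars_lt N t /\ tvars_lt N u
  | Imp B C => fvars_lt N B /\ fvars_lt N C
  | All B => fvars_lt N.+1 B
  end.

Definition tshift F (t : term F) : term F := tsubst (fun i => Var i.+1) t.

Definition up F (s : nat -> term F) (i : nat) : term F :=
  if i is j.+1 then tshift (s j) else Var 0.

Fixpoint fsubst F (s : nat -> term F) (A : form F) : form F :=
  match A with
  | Bot => Bot
  | Eq t u => Eq (tsubst s t) (tsubst s u)
  | Le t u => Le (tsubst s t) (tsubst s u)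
  | Imp B C => Imp (fsubst s B) (fsubst s C)
  | All B => All (fsubst (up s) B)
  end.

Definition fshift F (A : form F) : form F := fsubst (fun i => Var i.+1) A.

(* Instantiation of the outermost bound variable of the body of a quantifier. *)
Definition inst F (A : form F) (t : term F) : form F :=
  fsubst (fun i => if i is j.+1 then Var j else t) A.

Definition upd F (s : nat -> term F) (x : nat) (t : term F) : nat -> term F :=
  fun i => if i == x then t else s i.

(* A[x := t] for a free variable x. *)
Definition fsub1 F (A : form F) (x : nat) (t : term F) : form F :=
  fsubst (upd Var x t) A.

Definition bind F (x : nat) (A : form F) : form F :=
  fsubst (fun i => if i == x then Var 0 else Var i.+1) A.
Definition allv F (x : nat) (A : form F) : form F := All (bind x A).
Definition exv F (x : nat) (A : form F) : form F := Ex (bind x A).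

(* Bounded quantification of the variable x; meant for x not occurring in t. *)
Definition all_le F (x : nat) (t : term F) (A : form F) : form F :=
  allv x (Var x <=f t ->f A).
Definition ex_le F (x : nat) (t : term F) (A : form F) : form F :=
  exv x (Var x <=f t &f A).

(* Bounds by t each of the n variables x, x+1, ..., x+n-1. *)
Fixpoint alls_le F (x n : nat) (t : term F) (A : form F) : form F :=
  if n is m.+1 then all_le x t (alls_le x.+1 m t A) else A.

(* Natural deduction from the axioms T.  The formulas of T may have free
   variables and stand for their universal closures: they are not shifted by
   [prv_allI], so that every axiom can be generalized and instantiated. *)
Inductive prv F (T : form F -> Prop) : seq (form F) -> form F -> Prop :=
| prv_ax G A : T A -> prv T G A
| prv_hyp G A : List.In A G -> prv T G A
| prv_impI G A B : prv T (A :: G) B -> prv T G (Imp A B)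
| prv_impE G A B : prv T G (Imp A B) -> prv T G A -> prv T G B
| prv_raa G A : prv T (Not A :: G) Bot -> prv T G A
| prv_allI G A : prv T (map (@fshift F) G) A -> prv T G (All A)
| prv_allE G A t : prv T G (All A) -> prv T G (inst A t)
| prv_refl G t : prv T G (t =f t)
| prv_subst G A t u :
    prv T G (t =f u) -> prv T G (inst A t) -> prv T G (inst A u).

(* Function symbols.  [pvsym l n] are the n-ary symbols for the functions of
   Box^p_{l+1}: the closure of the initial functions under composition and
   limited recursion on notation, where for l > 0 the initial functions include
   bounded minimization of the functions of the previous level.  In particular
   the characteristic functions of (strict) Sigma^b_l formulas are terms. *)
Inductive pvsym : nat -> nat -> Type :=
| Fzero l : pvsym l 0
| Fsucc l : pvsym l 1
| Fhalf l : pvsym l 1               (* floor (x / 2) *)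
| Flen l : pvsym l 1                (* |x|, the length of x in binary *)
| Fadd l : pvsym l 2
| Fmul l : pvsym l 2
| Fsmash l : pvsym l 2              (* x # y = 2 ^ (|x| * |y|) *)
| Fcle l : pvsym l 2                (* 1 if x <= y, else 0 *)
| Fcond l : pvsym l 3               (* (c, x, y) |-> x if c = 0, else y *)
| Fproj l n (i : 'I_n) : pvsym l n
| Fcomp l m n (f : pvsym l m) (g : 'I_m -> pvsym l n) : pvsym l n
| Flrn l n (g : pvsym l n) (h : pvsym l n.+2) (b : pvsym l n.+1) : pvsym l n.+1
| Fmin l n (f : pvsym l n.+1) : pvsym l.+1 n.+1.

(* The inclusion of each level in the next. *)
Fixpoint flift l n (f : pvsym l n) : pvsym l.+1 n :=
  match f with
  | Fzero _ => Fzero _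
  | Fsucc _ => Fsucc _
  | Fhalf _ => Fhalf _
  | Flen _ => Flen _
  | Fadd _ => Fadd _
  | Fmul _ => Fmul _
  | Fsmash _ => Fsmash _
  | Fcle _ => Fcle _
  | Fcond _ => Fcond _
  | Fproj _ _ i => Fproj _ i
  | Fcomp _ _ _ f g => Fcomp (flift f) (fun i => flift (g i))
  | Flrn _ _ g h b => Flrn (flift g) (flift h) (flift b)
  | Fmin _ _ f => Fmin (flift f)
  end.

Definition tvec F n (s : seq (term F)) : 'I_n -> term F :=
  fun i => nth (Var 0) s i.
Definition tcons F n (t : term F) (a : 'I_n -> term F) : 'I_n.+1 -> term F :=
  fun i => if unlift ord0 i is Some j then a j else t.

Definition tO l : term (pvsym l) := App (Fzero l) (tvec [::]).
Definition tS l (x : term (pvsym l)) := App (Fsucc l) (tvec [:: x]).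
Definition thalf l (x : term (pvsym l)) := App (Fhalf l) (tvec [:: x]).
Definition tlen l (x : term (pvsym l)) := App (Flen l) (tvec [:: x]).
Definition tadd l (x y : term (pvsym l)) := App (Fadd l) (tvec [:: x; y]).
Definition tmul l (x y : term (pvsym l)) := App (Fmul l) (tvec [:: x; y]).
Definition tsmash l (x y : term (pvsym l)) := App (Fsmash l) (tvec [:: x; y]).
Definition tcle l (x y : term (pvsym l)) := App (Fcle l) (tvec [:: x; y]).
Definition tcond l (c x y : term (pvsym l)) :=
  App (Fcond l) (tvec [:: c; x; y]).
Definition tmin l (x y : term (pvsym l)) := tcond (tcle x y) y x.
Definition tdouble l (x : term (pvsym l)) := tmul (tS (tS (tO l))) x.

(* Buss's axioms BASIC. *)
Inductive basic_ax l : form (pvsym l) -> Prop :=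
| basic1 x y : basic_ax (y <=f x ->f y <=f tS x)
| basic2 x : basic_ax (x <>f tS x)
| basic3 x : basic_ax (tO l <=f x)
| basic4 x y : basic_ax ((x <=f y &f x <>f y) <->f tS x <=f y)
| basic5 x : basic_ax (x <>f tO l ->f tdouble x <>f tO l)
| basic6 x y : basic_ax (y <=f x |f x <=f y)
| basic7 x y : basic_ax ((x <=f y &f y <=f x) ->f x =f y)
| basic8 x y z : basic_ax ((x <=f y &f y <=f z) ->f x <=f z)
| basic9 : basic_ax (tlen (tO l) =f tO l)
| basic10 x : basic_ax (x <>f tO l ->f
    (tlen (tdouble x) =f tS (tlen x) &f tlen (tS (tdouble x)) =f tS (tlen x)))
| basic11 : basic_ax (tlen (tS (tO l)) =f tS (tO l))
| basic12 x y : basic_ax (x <=f y ->f tlen x <=f tlen y)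
| basic13 x y : basic_ax (tlen (tsmash x y) =f tS (tmul (tlen x) (tlen y)))
| basic14 y : basic_ax (tsmash (tO l) y =f tS (tO l))
| basic15 x : basic_ax (x <>f tO l ->f
    (tsmash (tS (tO l)) (tdouble x) =f tdouble (tsmash (tS (tO l)) x) &f
     tsmash (tS (tO l)) (tS (tdouble x)) =f tdouble (tsmash (tS (tO l)) x)))
| basic16 x y : basic_ax (tsmash x y =f tsmash y x)
| basic17 x y z : basic_ax (tlen x =f tlen y ->f tsmash x z =f tsmash y z)
| basic18 x y u v : basic_ax (tlen x =f tadd (tlen u) (tlen v) ->f
    tsmash x y =f tmul (tsmash u y) (tsmash v y))
| basic19 x y : basic_ax (x <=f tadd x y)
| basic20 x y : basic_ax ((x <=f y &f x <>f y) ->f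
    (tS (tdouble x) <=f tdouble y &f tS (tdouble x) <>f tdouble y))
| basic21 x y : basic_ax (tadd x y =f tadd y x)
| basic22 x : basic_ax (tadd x (tO l) =f x)
| basic23 x y : basic_ax (tadd x (tS y) =f tS (tadd x y))
| basic24 x y z : basic_ax (tadd (tadd x y) z =f tadd x (tadd y z))
| basic25 x y z : basic_ax (tadd x y <=f tadd x z <->f y <=f z)
| basic26 x : basic_ax (tmul x (tO l) =f tO l)
| basic27 x y : basic_ax (tmul x (tS y) =f tadd (tmul x y) x)
| basic28 x y : basic_ax (tmul x y =f tmul y x)
| basic29 x y z : basic_ax (tmul x (tadd y z) =f tadd (tmul x y) (tmul x z))
| basic30 x y z : basic_ax (tS (tO l) <=f x ->f
    (tmul x y <=f tmul x z <->f y <=f z))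
| basic31 x : basic_ax (x <>f tO l ->f tlen x =f tS (tlen (thalf x)))
| basic32 x y : basic_ax (x =f thalf y <->f
    (tdouble x =f y |f tS (tdouble x) =f y)).

(* Defining axioms of the remaining symbols common to all levels.  The
   recursion in [Flrn g h b] runs on the first argument, and its values are
   truncated to the bound b. *)
Inductive def_ax l : form (pvsym l) -> Prop :=
| def_cle1 x y : def_ax (x <=f y ->f tcle x y =f tS (tO l))
| def_cle0 x y : def_ax (Not (x <=f y) ->f tcle x y =f tO l)
| def_cond0 c x y : def_ax (c =f tO l ->f tcond c x y =f x)
| def_cond1 c x y : def_ax (c <>f tO l ->f tcond c x y =f y)
| def_proj n (i : 'I_n) a : def_ax (App (Fproj l i) a =f a i)
| def_comp m n (f : pvsym l m) (g : 'I_m -> pvsym l n) a :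
    def_ax (App (Fcomp f g) a =f App f (fun i => App (g i) a))
| def_lrn0 n (g : pvsym l n) h b a :
    def_ax (App (Flrn g h b) (tcons (tO l) a) =f
            tmin (App g a) (App b (tcons (tO l) a)))
| def_lrnS n (g : pvsym l n) h b y a :
    def_ax (y <>f tO l ->f
            App (Flrn g h b) (tcons y a) =f
            tmin (App h (tcons (App (Flrn g h b) (tcons (thalf y) a))
                               (tcons y a)))
                 (App b (tcons y a))).

(* [Fmin f] maps (z, xs) to the least y <= z such that f (y, xs) = 0, and to
   z + 1 if there is none. *)
Inductive min_ax : forall l, form (pvsym l) -> Prop :=
| min_bound l n (f : pvsym l n.+1) z a :
    min_ax (App (Fmin f) (tcons z a) <=f tS z)
| min_zero l n (f : pvsym l n.+1) z a :
    min_ax (App (Fmin f) (tcons z a) <=f z ->f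
            App (flift f) (tcons (App (Fmin f) (tcons z a)) a) =f tO l.+1)
| min_least l n (f : pvsym l n.+1) y z a :
    min_ax (y <=f z ->f App (flift f) (tcons y a) =f tO l.+1 ->f
            App (Fmin f) (tcons z a) <=f y).

(* [pv_pind] is the rule of induction on notation, for quantifier-free
   formulas; all axioms are quantifier-free, i.e. the theory is universal. *)
Inductive pv_ax l : form (pvsym l) -> Prop :=
| pv_basic A : basic_ax A -> pv_ax A
| pv_def A : def_ax A -> pv_ax A
| pv_min A : min_ax A -> pv_ax A
| pv_pind (A : form (pvsym l)) x :
    qf A ->
    prv (@pv_ax l) [::] (fsub1 A x (tO l)) ->
    prv (@pv_ax l) [::] (fsub1 A x (thalf (Var x)) ->f A) ->
    pv_ax A.

Lemma pv_ax_qf l (A : form (pvsym l)) : pv_ax A -> qf A.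
Proof. by case=> [B [] *|B [] *|B [] *|] //=. Qed.

(* The language and theory PV_k, for k >= 1. *)
Definition LPV (k : nat) : nat -> Type := pvsym k.-1.
Definition PV_proves (k : nat) (A : form (LPV k)) : Prop :=
  prv (@pv_ax k.-1) [::] A.

(* (k,2)-games with parameters xs = x_0, ..., x_(p-1).  The parameters are the
   variables 0, ..., p-1; in the formula, the first player's move is the
   variable p and the second player's move is the variable p+1. *)
Record game (k p : nat) := Game {
  gform : form (LPV k);
  gbound : term (LPV k);
  gform_qf : qf gform;
  gform_vars : fvars_lt p.+2 gform;
  gbound_vars : tvars_lt p gbound
}.

(* G(xs, u, v) *)
Definition gplay k p (G : game k p) (u v : term (LPV k)) : form (LPV k) :=
  fsubst (upd (upd Var p u) p.+1 v) (gform G).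

(* exists y <= t, forall z <= t, G(xs, y, z) *)
Definition first_player_wins k p (G : game k p) : form (LPV k) :=
  ex_le p (gbound G) (all_le p.+1 (gbound G) (gform G)).

(* (f, g) is a (k,2)-reduction from H to G.  Here y is the variable p, and
   w_j is the variable p+1+j. *)
Definition reduction k p (H G : game k p) (m : nat)
    (f : 'I_m.+1 -> term (LPV k)) (g : term (LPV k)) : Prop :=
  let s := gbound H in
  let t := gbound G in
  let y := p in
  let w (j : nat) := p.+1 + j in
  let quant (A : form (LPV k)) := alls_le (w 0) m.+1 s (all_le y t A) in
  [/\ (forall i : 'I_m.+1, tvars_lt (w i) (f i)) /\ tvars_lt (w m.+1) g,
      forall i : 'I_m.+1, PV_proves (quant (f i <=f s)),
      PV_proves (quant (g <=f t)) &
      PV_proves (quant (gplay G (Var y) g ->f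
        \big[@Or _/Bot]_(i < m.+1) gplay H (f i) (Var (w i))))].

(* Main.v *)
(* Left to right: suppose that the implication is provable, and let u_0, u_1, ...
   enumerate all terms so that w_i does not occur in u_i, nor do the later w_j.
   Let D say that y <= t, that every w_i <= s, and that every u_i is refuted,
   both as an answer to y in G and as a first move in H (w_i being the reply).
   All terms are listed, so in the term model over D the first player wins G
   but not H; as PV_k is universal, the provable implication would hold there,
   so finitely many formulas of D are already inconsistent with PV_k.
   Definition by cases turns this into a reduction: f_i is u_i cut off at s, and
   g is the first u_i that is a winning answer to y in G.  Instead of completing
   D to a maximal consistent set, truth in the term model is replaced by forcing,
   where the conditions are sets of formulas and an atom is forced when it is
   derivable.

   Right to left: if no first move wins H, then f_0, f_1, ... are answered in
   turn by w_0, w_1, ..., which contradicts the reduction at z = g. *)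

Require Import Defs.
From mathcomp Require Import all_boot.
From Stdlib Require List.
From Stdlib Require Import FunctionalExtensionality.

Set Implicit Arguments.
Unset Strict Implicit.
Unset Printing Implicit Defensive.

Local Open Scope fol_scope.

(** * Substitution *)

Definition scons F (t : term F) (s : nat -> term F) (i : nat) : term F :=
  if i is j.+1 then s j else t.

Lemma tsubst_ext_lt F N (t : term F) s s' :
  tvars_lt N t -> (forall i, i < N -> s i = s' i) -> tsubst s t = tsubst s' t.
Proof.
elim: t => [i|n f a IH] /= ht hs; first exact: hs.
by congr App; apply: functional_extensionality => i; apply: IH.
Qed.

Lemma tsubst_Var F (t : term F) : tsubst Var t = t.
Proof.
elim: t => [//|n f a IH] /=.
by congr App; apply: functional_extensionality.
Qed.

Lemma tsubst_comp F (s s' : nat -> term F) t :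
  tsubst s (tsubst s' t) = tsubst (fun i => tsubst s (s' i)) t.
Proof.
elim: t => [//|n f a IH] /=.
by congr App; apply: functional_extensionality.
Qed.

Lemma tsubst_id_lt F N (t : term F) s :
  tvars_lt N t -> (forall i, i < N -> s i = Var i) -> tsubst s t = t.
Proof. by move=> ht hs; rewrite -[RHS]tsubst_Var; apply: tsubst_ext_lt ht hs. Qed.

Lemma tvars_lt_le F M N (t : term F) : M <= N -> tvars_lt M t -> tvars_lt N t.
Proof.
move=> le_MN; elim: t => [i|n f a IH] /=; first by move/leq_trans; apply.
by move=> ha i; apply: IH.
Qed.

Lemma up_comp F (s s' : nat -> term F) :
  (fun i => tsubst (up s) (up s' i)) = up (fun i => tsubst s (s' i)).
Proof.
by apply: functional_extensionality => -[//|i] /=; rewrite /tshift !tsubst_comp.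
Qed.

Lemma fsubst_comp F (s s' : nat -> term F) A :
  fsubst s (fsubst s' A) = fsubst (fun i => tsubst s (s' i)) A.
Proof.
elim: A s s' => [|t u|t u|A IHA B IHB|A IHA] s s' //=.
- by rewrite !tsubst_comp.
- by rewrite !tsubst_comp.
- by rewrite IHA IHB.
- by rewrite IHA up_comp.
Qed.

Lemma fsubst_ext_lt F N (A : form F) s s' :
  fvars_lt N A -> (forall i, i < N -> s i = s' i) -> fsubst s A = fsubst s' A.
Proof.
elim: A N s s' => [|t u|t u|A IHA B IHB|A IHA] N s s' //=.
- by case=> ht hu hs; rewrite (tsubst_ext_lt ht hs) (tsubst_ext_lt hu hs).
- by case=> ht hu hs; rewrite (tsubst_ext_lt ht hs) (tsubst_ext_lt hu hs).
- by case=> hA hB hs; rewrite (IHA _ _ _ hA hs) (IHB _ _ _ hB hs).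
- by move=> hA hs; congr All; apply: IHA hA _ => -[//|i] /= /hs ->.
Qed.

Lemma fsubst_Var F (A : form F) : fsubst Var A = A.
Proof.
elim: A => [|t u|t u|A IHA B IHB|A IHA] //=; rewrite ?tsubst_Var ?IHA ?IHB //.
by congr All; rewrite -[RHS]IHA; congr fsubst;
  apply: functional_extensionality => -[].
Qed.

(** Every environment [scons t s] thus arises by instantiating a quantifier, so [prv_allE] and
    [prv_subst] apply whatever the values of the other variables. *)
Lemma inst_fsubst_up F (s : nat -> term F) A t :
  inst (fsubst (up s) A) t = fsubst (scons t s) A.
Proof.
rewrite /inst fsubst_comp; congr fsubst.
apply: functional_extensionality => -[//|i] /=.
by rewrite /tshift tsubst_comp tsubst_Var.
Qed.

Lemma fsubst_bind F (s : nat -> term F) x A :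
  fsubst s (bind x A) =
  fsubst (fun i => if i == x then s 0 else s i.+1) A.
Proof.
rewrite /bind fsubst_comp; congr fsubst.
by apply: functional_extensionality => i; case: eqP.
Qed.

Lemma inst_bind F x (A : form F) t : inst (bind x A) t = fsub1 A x t.
Proof. by rewrite /inst fsubst_bind. Qed.

Lemma fsub1_id F x (A : form F) : fsub1 A x (Var x) = A.
Proof.
rewrite -[RHS]fsubst_Var; congr fsubst.
by apply: functional_extensionality => i; rewrite /upd; case: eqP => // ->.
Qed.

Fixpoint tbound F (t : term F) : nat :=
  match t with
  | Var i => i.+1
  | App n f a => \max_(i < n) tbound (a i)
  end.

Lemma tvars_lt_tbound F (t : term F) : tvars_lt (tbound t) t.
Proof.
elim: t => [i|n f a IH] /=; first exact: leqnn.
by move=> i; apply: tvars_lt_le (IH i); apply: (leq_bigmax (F := fun j => tbound (a j))).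
Qed.

Lemma fvars_lt_le F M N (A : form F) : M <= N -> fvars_lt M A -> fvars_lt N A.
Proof.
elim: A M N => [|t u|t u|A IHA B IHB|A IHA] M N le_MN //=.
- by case=> /(tvars_lt_le le_MN) ? /(tvars_lt_le le_MN).
- by case=> /(tvars_lt_le le_MN) ? /(tvars_lt_le le_MN).
- by case=> /(IHA _ _ le_MN) ? /(IHB _ _ le_MN).
- exact: IHA.
Qed.

Lemma fvars_lt_exists F (A : form F) : exists N, fvars_lt N A.
Proof.
have two (t u : term F) : exists N, tvars_lt N t /\ tvars_lt N u.
  exists (maxn (tbound t) (tbound u)); split.
    exact: tvars_lt_le (leq_maxl _ _) (tvars_lt_tbound t).
  exact: tvars_lt_le (leq_maxr _ _) (tvars_lt_tbound u).
elim: A => [|t u|t u|A [M IHA] B [N IHB]|A [N IHA]]; first by exists 0.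
- exact: two.
- exact: two.
- exists (maxn M N); split.
    exact: fvars_lt_le (leq_maxl _ _) IHA.
  exact: fvars_lt_le (leq_maxr _ _) IHB.
- by exists N; apply: fvars_lt_le (leqnSn N) IHA.
Qed.

(** * Derived rules *)

Lemma prv_weaken F (T : form F -> Prop) G G' A :
  List.incl G G' -> prv T G A -> prv T G' A.
Proof.
move=> sGG' pA; elim: pA G' sGG' => {G A}.
- by move=> G A hA G' _; apply: prv_ax.
- by move=> G A hA G' sGG'; apply: prv_hyp; apply: sGG'.
- move=> G A B _ IH G' sGG'; apply: prv_impI; apply: IH.
  by move=> C [->|/sGG' ?]; [left|right].
- by move=> G A B _ IHAB _ IHA G' sGG'; apply: prv_impE (IHAB _ sGG') (IHA _ sGG').
- move=> G A _ IH G' sGG'; apply: prv_raa; apply: IH.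
  by move=> C [->|/sGG' ?]; [left|right].
- by move=> G A _ IH G' sGG'; apply: prv_allI; apply: IH; apply: List.incl_map.
- by move=> G A t _ IH G' sGG'; apply: prv_allE; apply: IH.
- by move=> *; apply: prv_refl.
- by move=> G A t u _ IHtu _ IHA G' sGG'; apply: prv_subst (IHtu _ sGG') (IHA _ sGG').
Qed.

Lemma prv_weaken1 F (T : form F -> Prop) G A B : prv T G A -> prv T (B :: G) A.
Proof. by apply: prv_weaken => C; right. Qed.

Lemma prv_weaken0 F (T : form F -> Prop) G A : prv T [::] A -> prv T G A.
Proof. exact: prv_weaken (List.incl_nil_l G). Qed.

Lemma prv_hd F (T : form F -> Prop) G A : prv T (A :: G) A.
Proof. by apply: prv_hyp; left. Qed.

Lemma prv_impD F (T : form F -> Prop) G A B : prv T G (A ->f B) -> prv T (A :: G) B.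
Proof. by move=> /(prv_weaken1 A) /prv_impE; apply; apply: prv_hd. Qed.

Lemma prv_cut F (T : form F -> Prop) G G' C :
  (forall B, List.In B G' -> prv T G B) -> prv T G' C -> prv T G C.
Proof.
elim: G' C => [|B G' IH] C hB pC; first exact: prv_weaken0.
apply: prv_impE (hB B _); last by left.
by apply: IH (prv_impI pC) => D hD; apply: hB; right.
Qed.

Lemma prv_botE F (T : form F -> Prop) G A : prv T G Bot -> prv T G A.
Proof. by move=> pB; apply: prv_raa; apply: prv_weaken1. Qed.

Lemma prv_cases F (T : form F -> Prop) G A C :
  prv T (A :: G) C -> prv T (Not A :: G) C -> prv T G C.
Proof.
move=> pA pN; apply: prv_raa; apply: (prv_impE (prv_hd _ _ _)).
apply: prv_impE (prv_weaken1 _ (prv_impI pN)) _; apply: prv_impI.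
apply: (prv_impE (A := C)); first by apply: prv_hyp; right; left.
apply: prv_impE (prv_hd _ _ _).
by do 2! apply: prv_weaken1; apply: prv_impI.
Qed.

Lemma prv_andI F (T : form F -> Prop) G A B :
  prv T G A -> prv T G B -> prv T G (A &f B).
Proof.
move=> pA pB; apply: prv_impI.
by apply: prv_impE (prv_weaken1 _ pB); apply: prv_impE (prv_hd _ _ _) (prv_weaken1 _ pA).
Qed.

Lemma prv_andEl F (T : form F -> Prop) G A B : prv T G (A &f B) -> prv T G A.
Proof.
move=> pAB; apply: prv_raa; apply: prv_impE (prv_weaken1 _ pAB) _.
apply: prv_impI; apply: prv_botE; apply: prv_impE (prv_hd _ _ _).
by apply: prv_hyp; right; left.
Qed.

Lemma prv_andEr F (T : form F -> Prop) G A B : prv T G (A &f B) -> prv T G B.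
Proof.
move=> pAB; apply: prv_raa; apply: prv_impE (prv_weaken1 _ pAB) _.
by apply: prv_impI; apply: prv_weaken1; apply: prv_hd.
Qed.

Lemma prv_orIl F (T : form F -> Prop) G A B : prv T G A -> prv T G (A |f B).
Proof.
move=> pA; apply: prv_impI; apply: prv_botE.
by apply: prv_impE (prv_hd _ _ _) (prv_weaken1 _ pA).
Qed.

Lemma prv_orIr F (T : form F -> Prop) G A B : prv T G B -> prv T G (A |f B).
Proof. by move=> pB; apply: prv_impI; apply: prv_weaken1. Qed.

Lemma prv_bigorI F (T : form F -> Prop) G n (B : 'I_n -> form F) i :
  prv T G (B i) -> prv T G (\big[@Or F/Bot]_(j < n) B j).
Proof.
move=> pB; have: i \in index_enum 'I_n by rewrite mem_index_enum.
elim: (index_enum _) => [//|j r IH]; rewrite big_cons inE.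
by case: eqP => [<- _|_ /IH]; [apply: prv_orIl | apply: prv_orIr].
Qed.

Lemma prv_bigorE F (T : form F -> Prop) G n (B : 'I_n -> form F) :
  (forall i, prv T G (Not (B i))) ->
  prv T G (\big[@Or F/Bot]_(j < n) B j) -> prv T G Bot.
Proof.
move=> pN; elim: (index_enum _) => [|j r IH]; first by rewrite big_nil.
by rewrite big_cons => /prv_impE pj; apply: IH; apply: pj.
Qed.

Lemma prv_exI F (T : form F -> Prop) G A t : prv T G (inst A t) -> prv T G (Ex A).
Proof.
move=> pA; apply: prv_impI; apply: prv_impE (prv_weaken1 _ pA).
exact: (prv_allE t (prv_hd _ _ (All (Not A)))).
Qed.

(* Generalize all the variables of A, which [prv_allI] allows in the empty
   context, and instantiate them from the outermost binder inwards. *)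
Lemma prv_fsubst0 F (T : form F -> Prop) (s : nat -> term F) A :
  prv T [::] A -> prv T [::] (fsubst s A).
Proof.
have closure n B : prv T [::] B -> prv T [::] (iter n (@All F) B).
  by move=> pB; elim: n => [//|n IH]; apply: prv_allI.
have inst_iter n B r : (forall i, n <= i -> r i = Var (i - n)) ->
    prv T [::] (iter n (@All F) B) -> prv T [::] (fsubst r B).
  elim: n B r => [|n IH] B r hr.
    have -> : r = Var by apply: functional_extensionality => i; rewrite hr ?subn0.
    by rewrite fsubst_Var.
  rewrite iterSr => /(IH _ (fun i => r i.+1)) pB.
  have -> : r = scons (r 0) (fun i => r i.+1).
    by apply: functional_extensionality => -[].
  rewrite -inst_fsubst_up; apply: prv_allE; apply: pB => i le_ni.
  by rewrite hr.
have [N hN] := fvars_lt_exists A.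
(* Stripping [N] binders lowers the indices from [N] on by [N]. These indices do not occur in [A],
   so [s] may be altered there to fit. *)
move=> /(closure N) /(inst_iter N A (fun i => if i < N then s i else Var (i - N))) pA.
rewrite (fsubst_ext_lt (s' := fun i => if i < N then s i else Var (i - N)) hN).
  by apply: pA => i; rewrite ltnNge => ->.
by move=> i ->.
Qed.

(** The hypotheses are discharged into implications, which reduces the claim to the empty
    context. *)
Lemma prv_fsubst F (T : form F -> Prop) (s : nat -> term F) G A :
  prv T G A -> prv T (map (fsubst s) G) (fsubst s A).
Proof.
elim: G A => [|B G IH] A; first exact: prv_fsubst0.
by move=> /prv_impI /IH /= /prv_impD.
Qed.

Lemma prv_fsubst_eq F (T : form F -> Prop) G (s : nat -> term F) A t u :
  prv T G (t =f u) -> prv T G (fsubst (scons t s) A) ->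
  prv T G (fsubst (scons u s) A).
Proof.
move=> tu; rewrite -(inst_fsubst_up s A t) -(inst_fsubst_up s A u).
exact: prv_subst tu.
Qed.

Lemma prv_sym F (T : form F -> Prop) G t u : prv T G (t =f u) -> prv T G (u =f t).
Proof.
move=> tu.
(* In the template [Var 0 =f Var 1] variable 1 is sent to [t]; replacing [t] by [u] at variable 0
   turns [t =f t] into [u =f t]. *)
have := @prv_fsubst_eq _ T G (fun=> t) (Var 0 =f Var 1) t u tu.
by apply; apply: prv_refl.
Qed.

Lemma prv_trans F (T : form F -> Prop) G t u v :
  prv T G (t =f u) -> prv T G (u =f v) -> prv T G (t =f v).
Proof.
by move=> tu uv; apply: (@prv_fsubst_eq _ T G (fun=> t) (Var 1 =f Var 0) u v uv tu).
Qed.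

Lemma prv_le_eq F (T : form F -> Prop) G t u v :
  prv T G (t =f u) -> prv T G (u <=f v) -> prv T G (t <=f v).
Proof.
move=> /prv_sym tu uv.
exact: (@prv_fsubst_eq _ T G (fun=> v) (Var 0 <=f Var 1) u t tu uv).
Qed.

(** * Forcing over the term model *)

(** The set [D] may be infinite, but a derivation draws on a finite list of its members: compactness
    is built in. Free variables of [D] act as constants. *)
Definition derives F (T D : form F -> Prop) (A : form F) : Prop :=
  exists2 l, (forall B, List.In B l -> D B) & prv T l A.

Lemma derives_prv F (T D : form F -> Prop) A : prv T [::] A -> derives T D A.
Proof. by exists [::]. Qed.

Lemma derives_ax F (T D : form F -> Prop) A : D A -> derives T D A.
Proof. by move=> DA; exists [:: A]; [move=> B [<-|[]] | apply: prv_hd]. Qed.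

Lemma derives_mono F (T D D' : form F -> Prop) A :
  (forall B, D B -> D' B) -> derives T D A -> derives T D' A.
Proof. by move=> sDD' [l hl pA]; exists l => // B /hl /sDD'. Qed.

Lemma derives_prv1 F (T D : form F -> Prop) A B :
  prv T [:: A] B -> derives T D A -> derives T D B.
Proof.
move=> pB [l hl pA]; exists l => //.
by apply: prv_cut pB => C [<-|[]].
Qed.

Lemma derives_impE F (T D : form F -> Prop) A B :
  derives T D (A ->f B) -> derives T D A -> derives T D B.
Proof.
move=> [l hl pAB] [l' hl' pA]; exists (l ++ l').
  by move=> C hC; case: (List.in_app_or _ _ _ hC) => [/hl|/hl'].
apply: (prv_impE (A := A)); first by apply: prv_weaken pAB; apply: List.incl_appl.
by apply: prv_weaken pA; apply: List.incl_appr.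
Qed.

Definition dadd F (D : form F -> Prop) A B : Prop := B = A \/ D B.

(** The list may contain [A] anywhere and repeatedly. Induction on the list with [B] general: the
    head moves into the conclusion before the induction hypothesis removes [A] from the tail. *)
Lemma derives_impI F (T D : form F -> Prop) A B :
  derives T (dadd D A) B -> derives T D (A ->f B).
Proof.
move=> [l]; elim: l B => [|C l IH] B hl pB.
  by apply: derives_prv; apply: prv_impI; apply: prv_weaken1.
have hl' C' : List.In C' l -> dadd D A C' by move=> ?; apply: hl; right.
have {IH} [r hr pCB] := IH _ hl' (prv_impI pB).
case: (hl C) => [|eqCA|DC]; first by left.
  exists r => //; apply: prv_impI; move: (prv_impD pCB); rewrite eqCA => pAB.
  by apply: prv_impE pAB (prv_hd _ _ _).
exists (C :: r); first by move=> C' [<- //|/hr].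
apply: prv_impI; apply: (prv_impE (A := C)); last by apply: prv_hyp; right; left.
by apply: prv_weaken (prv_impD pCB) => E [->|?]; [left | right; right].
Qed.

(** Kripke forcing with sets of formulas ordered by inclusion as conditions and all terms as
    constant domain. [Bot] is treated as an atom, so inconsistent conditions are allowed and force
    it. The environment [e] keeps the recursion structural under quantifiers. *)
Fixpoint forces F (T D : form F -> Prop) (e : nat -> term F) (A : form F) : Prop :=
  match A with
  | Imp B C => forall D' : form F -> Prop, (forall E, D E -> D' E) ->
                 forces T D' e B -> forces T D' e C
  | All B => forall t, forces T D (scons t e) B
  | _ => derives T D (fsubst e A)
  end.

Lemma forces_mono F (T D D' : form F -> Prop) e A :
  (forall B, D B -> D' B) -> forces T D e A -> forces T D' e A.
Proof.
elim: A D D' e => [|t u|t u|A IHA B IHB|A IHA] D D' e sDD' /=.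
- exact: derives_mono.
- exact: derives_mono.
- exact: derives_mono.
- by move=> fAB D'' sD'D''; apply: fAB => C /sDD' /sD'D''.
- by move=> fA t; apply: IHA (fA t).
Qed.

(** The bridge from forcing back to derivability. A forced implication is tested at the condition
    extended by its antecedent, and the deduction theorem returns to [D]. *)
Lemma forces_qf F (T D : form F -> Prop) e A :
  qf A -> forces T D e A <-> derives T D (fsubst e A).
Proof.
elim: A D e => [|t u|t u|A IHA B IHB|//] D e //= [/IHA fA /IHB fB]; split.
  move=> fAB; apply: derives_impI; apply/fB; apply: fAB; first by right.
  by apply/fA; apply: derives_ax; left.
move=> dAB D' sDD' /fA dA; apply/fB.
exact: derives_impE (derives_mono sDD' dAB) dA.
Qed.

Lemma forces_fsubst F (T D : form F -> Prop) e s A :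
  forces T D e (fsubst s A) <-> forces T D (fun i => tsubst e (s i)) A.
Proof.
elim: A D e s => [|t u|t u|A IHA B IHB|A IHA] D e s /=.
- by [].
- by rewrite !tsubst_comp.
- by rewrite !tsubst_comp.
- by split=> fAB D' sDD' /IHA /(fAB _ sDD') /IHB.
- have sconsE t : (fun i => tsubst (scons t e) (up s i)) =
                  scons t (fun i => tsubst e (s i)).
    by apply: functional_extensionality => -[//|i] /=; rewrite /tshift tsubst_comp.
  by split=> fA t; move: (fA t); rewrite IHA sconsE.
Qed.

Lemma forces_bind F (T D : form F -> Prop) e t x A :
  forces T D (scons t e) (bind x A) <-> forces T D (upd e x t) A.
Proof.
rewrite /bind forces_fsubst.
have -> // : (fun i => tsubst (scons t e) (if i == x then Var 0 else Var i.+1)) =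
             upd e x t.
by apply: functional_extensionality => i; rewrite /upd; case: eqP.
Qed.

Lemma forces_allv F (T D : form F -> Prop) e x A :
  forces T D e (allv x A) <-> forall u, forces T D (upd e x u) A.
Proof. by split=> fA u; apply/forces_bind; apply: fA. Qed.

(** Forcing is classical: implication and universal quantification inherit stability from their
    parts, and the other connectives are abbreviations. For an atom, stability comes from the
    classical calculus, by passing to the condition extended by the negated atom. *)
Lemma forces_raa F (T D : form F -> Prop) e A :
  forces T D e (Not (Not A)) -> forces T D e A.
Proof.
have atom (B : form F) D' : (forall D'', (forall E, D' E -> D'' E) ->
    (forall D3, (forall E, D'' E -> D3 E) -> derives T D3 B -> derives T D3 Bot) ->
    derives T D'' Bot) -> derives T D' B.
  move=> fB; apply: (@derives_prv1 _ _ _ (Not (Not B))).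
    apply: prv_raa; apply: prv_impE (prv_hd _ _ _).
    by apply: prv_hyp; right; left.
  apply: derives_impI; apply: fB => [E|D3 sD dB]; first by right.
  by apply: derives_impE dB; apply: derives_ax; apply: sD; left.
elim: A D e => [|t u|t u|A IHA B IHB|A IHA] D e.
- by apply: (atom Bot).
- exact: (atom (fsubst e (t =f u))).
- exact: (atom (fsubst e (t <=f u))).
- move=> fAB D' sDD' fA; apply: IHB => D1 sD'D1 fnB.
  apply: fAB => [E /sDD' /sD'D1 //|D2 sD12 fAB2].
  apply: (fnB D2 sD12); apply: fAB2 => //.
  by apply: forces_mono fA => E /sD'D1 /sD12.
- move=> fA t; apply: IHA => D1 sDD1 fnA.
  by apply: fA => // D2 sD12 fA2; apply: (fnA D2 sD12 (fA2 t)).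
Qed.

(* The two environments instantiate the same template s with t and with u. *)
Lemma forces_eq F (T D : form F -> Prop) (s : nat -> term F) t u A :
  derives T D (t =f u) ->
  forces T D (fun i => tsubst (scons t Var) (s i)) A ->
  forces T D (fun i => tsubst (scons u Var) (s i)) A.
Proof.
have atom B D' r t' u' : derives T D' (t' =f u') ->
    derives T D' (fsubst (fun i => tsubst (scons t' Var) (r i)) B) ->
    derives T D' (fsubst (fun i => tsubst (scons u' Var) (r i)) B).
  move=> dtu; apply: derives_impE.
  apply: derives_prv1 dtu; apply: prv_impI.
  rewrite -(fsubst_comp (scons t' Var)) -(fsubst_comp (scons u' Var)).
  apply: (prv_fsubst_eq (t := t')); last exact: prv_hd.
  by apply: prv_weaken1; apply: prv_hd.
(* Transport runs backwards, from [u] to [t], in the antecedent of an implication. *)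
have eqC D' t' u' : derives T D' (t' =f u') -> derives T D' (u' =f t').
  by apply: derives_prv1; apply/prv_sym/prv_hd.
elim: A D s t u => [|v w|v w|A IHA B IHB|A IHA] D s t u dtu.
- exact: (atom Bot).
- exact: (atom (v =f w)).
- exact: (atom (v <=f w)).
- move=> fAB D' sDD' fA; have dtu' := derives_mono sDD' dtu.
  by apply: (IHB _ _ _ _ dtu'); apply: fAB => //; apply: IHA fA; apply: eqC.
- move=> fA v.
  have sconsE w : scons v (fun i => tsubst (scons w Var) (s i)) =
      (fun i => tsubst (scons w Var) (scons (tshift v) s i)).
    apply: functional_extensionality => -[|//] /=.
    by rewrite /tshift tsubst_comp tsubst_Var.
  by rewrite sconsE; apply: IHA dtu _; rewrite -sconsE.
Qed.

(** Quantifier-freeness is what makes the axioms forced: their instances are derivable, and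
    [forces_qf] applies. The logical rules hold at every condition, [prv_raa] by stability and
    [prv_subst] by [forces_eq]. *)
Lemma forces_sound F (T : form F -> Prop) G A :
  (forall B, T B -> qf B) -> prv T G A ->
  forall D e, (forall B, List.In B G -> forces T D e B) -> forces T D e A.
Proof.
move=> qfT; elim=> {G A}.
- move=> G A TA D e _; apply/forces_qf; first exact: qfT.
  by apply: derives_prv; apply: prv_fsubst0; apply: prv_ax.
- by move=> G A GA D e; apply.
- move=> G A B _ IH D e hG D' sDD' fA; apply: IH => C [<- //|/hG].
  exact: forces_mono.
- by move=> G A B _ IHAB _ IHA D e hG; apply: (IHAB D e hG) => //; apply: IHA.
- move=> G A _ IH D e hG; apply: forces_raa => D' sDD' fA; apply: IH => C [<- //|/hG].
  exact: forces_mono.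
- move=> G A _ IH D e hG t; apply: IH => C /List.in_map_iff [B [<- /hG fB]].
  by rewrite /fshift forces_fsubst.
- move=> G A t _ IH D e hG; rewrite /inst forces_fsubst.
  have := IH D e hG (tsubst e t); congr forces.
  by apply: functional_extensionality => -[].
- by move=> G t D e _; apply: derives_prv; apply: prv_refl.
- move=> G A t u _ IHtu _ IHA D e hG.
  have := IHA D e hG; rewrite /inst !forces_fsubst.
  have sconsE v : (fun i => tsubst e (if i is j.+1 then Var j else v)) =
      (fun i => tsubst (scons (tsubst e v) Var)
                  (if i is j.+1 then tshift (e j) else Var 0)).
    apply: functional_extensionality => -[//|i] /=.
    by rewrite /tshift tsubst_comp tsubst_Var.
  by rewrite !sconsE; apply: forces_eq; apply: (IHtu D e hG).
Qed.

Lemma forces_and F (T D : form F -> Prop) e A B :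
  forces T D e A -> forces T D e B -> forces T D e (A &f B).
Proof.
move=> fA fB D' sDD' fAB; apply: (fAB D') => //; first exact: forces_mono fA.
exact: forces_mono fB.
Qed.

Lemma forces_ex_leI F (T D : form F -> Prop) e x t A u :
  derives T D (u <=f tsubst (upd e x u) t) -> forces T D (upd e x u) A ->
  forces T D e (ex_le x t A).
Proof.
move=> du fA; have fB : forces T D (scons u e) (bind x (Var x <=f t &f A)).
  by apply/forces_bind; apply: forces_and fA; rewrite /= {1}/upd eqxx.
by move=> D' sDD' /(_ u) fN; apply: (fN D') => //; apply: forces_mono fB.
Qed.

(** [Ex] is a negated universal, so a forced existential gives no witness outright; it lets one be
    assumed, in an extended condition, while deriving [Bot]. *)
Lemma forces_ex_leE F (T D : form F -> Prop) e x t A :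
  (forall (D' : form F -> Prop) u, (forall E, D E -> D' E) ->
     derives T D' (u <=f tsubst (upd e x u) t) -> forces T D' (upd e x u) A ->
     derives T D' Bot) ->
  forces T D e (ex_le x t A) -> derives T D Bot.
Proof.
move=> hA fEx; apply: fEx => // u D1 sDD1 fB.
have /forces_bind {}fB : forces T D1 (scons u e) (bind x (Var x <=f t &f A)) by [].
apply: fB => // D2 sD12 du D3 sD23 fA.
apply: (hA D3 u) => //; first by move=> E /sDD1 /sD12 /sD23.
by apply: (derives_mono sD23); move: du; rewrite /= {1}/upd eqxx.
Qed.

Lemma forces_all_le F (T D : form F -> Prop) e x t A :
  forces T D e (all_le x t A) <->
  forall (D' : form F -> Prop) u, (forall E, D E -> D' E) ->
    derives T D' (u <=f tsubst (upd e x u) t) -> forces T D' (upd e x u) A.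
Proof.
have updE u : upd e x u x = u by rewrite /upd eqxx.
rewrite /all_le forces_allv; split=> [fA D' u sDD' du|hA u D' sDD' /=].
  by apply: (fA u) => //=; rewrite updE.
by rewrite updE; apply: hA.
Qed.

(** * Enumeration of the terms *)

Definition ord0_fun X (i : 'I_0) : X :=
  match notF (valP i) with end.

Definition ordS_fun X n (x : X) (g : 'I_n -> X) (i : 'I_n.+1) : X :=
  if unlift ord0 i is Some j then g j else x.

Fixpoint funs_into X (s : seq X) n : seq ('I_n -> X) :=
  if n is m.+1 then
    List.flat_map (fun x => map (ordS_fun x) (funs_into s m)) s
  else [:: @ord0_fun X].

Lemma in_funs_into X (s : seq X) n (a : 'I_n -> X) :
  (forall i, List.In (a i) s) -> List.In a (funs_into s n).
Proof.
elim: n a => [|n IH] a ha /=.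
  by left; apply: functional_extensionality => -[].
apply/List.in_flat_map; exists (a ord0); split=> //.
apply/List.in_map_iff; exists (fun i => a (lift ord0 i)); split; last exact: IH.
apply: functional_extensionality => i; rewrite /ordS_fun.
by case: unliftP => [j ->|->].
Qed.

Definition base_syms l n : seq (pvsym l n) :=
  map (@Fproj l n) (enum 'I_n) ++
  match n with
  | 0 => [:: Fzero l]
  | 1 => [:: Fsucc l; Fhalf l; Flen l]
  | 2 => [:: Fadd l; Fmul l; Fsmash l; Fcle l]
  | 3 => [:: Fcond l]
  | _ => [::]
  end.

(** The stage [d] limits both the nesting of a symbol and the inner arity [m] of its compositions,
    as neither is determined by [l] and [n]; this keeps each list finite. *)
Fixpoint syms d l n {struct d} : seq (pvsym l n) :=
  if d is c.+1 then
    base_syms l n ++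
    List.flat_map (fun m =>
      List.flat_map (fun f => map (Fcomp f) (funs_into (syms c l n) m))
        (syms c l m)) (iota 0 d) ++
    match n return seq (pvsym l n) with
    | m.+1 => List.flat_map (fun g => List.flat_map (fun h =>
                map (Flrn g h) (syms c l m.+1)) (syms c l m.+2)) (syms c l m)
    | 0 => [::]
    end ++
    match l, n return seq (pvsym l n) with
    | l'.+1, m.+1 => map (@Fmin l' m) (syms c l' m.+1)
    | _, _ => [::]
    end
  else [::].

Lemma in_iota_lt m d : m < d -> List.In m (iota 0 d).
Proof.
move=> lt_md; have : m \in iota 0 d by rewrite mem_iota add0n.
elim: (iota 0 d) => [//|i r IH]; rewrite inE => /orP [/eqP ->|/IH ?]; by [left|right].
Qed.

(** Membership is asked at all late stages, so that finitely many objects share a stage, the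
    maximum, without a proof that [s] is monotone. *)
Definition eventually_in X (s : nat -> seq X) (x : X) : Prop :=
  exists d, forall c, d <= c -> List.In x (s c).

Lemma eventually_in_fun X (s : nat -> seq X) n (a : 'I_n -> X) :
  (forall i, eventually_in s (a i)) ->
  exists d, forall c, d <= c -> List.In a (funs_into (s c) n).
Proof.
case/fin_all_exists=> d hd; exists (\max_(i < n) d i) => c le_dc.
apply: in_funs_into => i; apply: hd; apply: leq_trans le_dc.
exact: (leq_bigmax (F := d)).
Qed.

Lemma in_base_syms d l n (f : pvsym l n) :
  List.In f (base_syms l n) -> List.In f (syms d.+1 l n).
Proof. by move=> hf; apply: List.in_or_app; left. Qed.

Lemma in_syms l n (f : pvsym l n) : eventually_in (fun d => syms d l n) f.
Proof.
have base l' n' (h : pvsym l' n') : List.In h (base_syms l' n') ->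
    eventually_in (fun d => syms d l' n') h.
  by move=> hh; exists 1 => -[//|c] _; apply: in_base_syms.
elim: f => {l n}; try by move=> l; apply: base; apply: List.in_or_app; right => /=; tauto.
- move=> l n i; apply: base; apply: List.in_or_app; left.
  apply/List.in_map_iff; exists i; split=> //.
  have : i \in enum 'I_n by rewrite mem_enum.
  by elim: (enum _) => [//|j r IH]; rewrite inE => /orP [/eqP ->|/IH ?]; [left|right].
- move=> l m n f [d1 h1] g /eventually_in_fun [d2 h2].
  exists (maxn m (maxn d1 d2)).+1 => -[//|c]; rewrite ltnS !geq_max => /and3P [mc dc1 dc2].
  apply: List.in_or_app; right; apply: List.in_or_app; left.
  apply/List.in_flat_map; exists m; split; first by apply: in_iota_lt.
  apply/List.in_flat_map; exists f; split; first exact: h1.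
  by apply/List.in_map_iff; exists g; split=> //; apply: h2.
- move=> l n g [d1 h1] h [d2 h2] b [d3 h3].
  exists (maxn d1 (maxn d2 d3)).+1 => -[//|c]; rewrite ltnS !geq_max => /and3P [dc1 dc2 dc3].
  apply: List.in_or_app; right; apply: List.in_or_app; right; apply: List.in_or_app; left.
  apply/List.in_flat_map; exists g; split; first exact: h1.
  apply/List.in_flat_map; exists h; split; first exact: h2.
  by apply/List.in_map_iff; exists b; split=> //; apply: h3.
- move=> l n f [d h]; exists d.+1 => -[//|c]; rewrite ltnS => dc.
  do 3 (apply: List.in_or_app; right).
  by apply/List.in_map_iff; exists f; split=> //; apply: h.
Qed.

Fixpoint terms l d : seq (term (pvsym l)) :=
  if d is c.+1 then
    map Var (iota 0 d) ++
    List.flat_map (fun n =>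
      List.flat_map (fun f => map (App f) (funs_into (terms l c) n))
        (syms c l n)) (iota 0 d)
  else [::].

Lemma in_terms l (t : term (pvsym l)) : eventually_in (terms l) t.
Proof.
elim: t => [i|n f a /eventually_in_fun [d1 h1]].
  exists i.+1 => -[//|c] lt_ic; apply: (List.in_or_app (map Var (iota 0 c.+1))); left.
  exact: (List.in_map (@Var (pvsym l)) _ _ (in_iota_lt lt_ic)).
have [d2 h2] := in_syms f.
exists (maxn n (maxn d1 d2)).+1 => -[//|c]; rewrite ltnS !geq_max => /and3P [nc dc1 dc2].
apply: (List.in_or_app (map Var (iota 0 c.+1))); right.
apply/List.in_flat_map; exists n; split; first by apply: in_iota_lt.
apply/List.in_flat_map; exists f; split; first exact: h2.
by apply/List.in_map_iff; exists a; split=> //; apply: h1.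
Qed.

Definition term_enum l (i : nat) : term (pvsym l) :=
  if unpickle (logn 2 i) is Some (d, j) then nth (Var 0) (terms l d) j else Var 0.

(* Only the exponent of 2 in the index matters, so every term recurs. *)
Lemma term_enum_surj l (t : term (pvsym l)) N :
  exists2 i, N <= i & term_enum l i = t.
Proof.
have [d /(_ d (leqnn d)) td] := in_terms t.
have [j tj] : exists j, nth (Var 0) (terms l d) j = t.
  elim: (terms l d) td => [//|u r IH] [->|/IH [j tj]]; first by exists 0.
  by exists j.+1.
(* The power of 2 codes where [t] is listed; the odd factor brings the index above [N] and leaves
   the exponent of 2 unchanged. *)
exists (2 ^ pickle (d, j) * N.*2.+1).
  apply: leq_trans (leq_pmull _ _); last by rewrite expn_gt0.
  by rewrite -addnn -addnS leq_addr.
rewrite /term_enum lognM ?expn_gt0 // pfactorK // logn_coprime ?addn0 ?pickleK //.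
by rewrite prime_coprime // dvdn2 /= odd_double.
Qed.

(** For [N = p.+1] the variable [N + i] is w_i, so the i-th candidate contains neither w_i nor a
    later reply. A term met too early is replaced by [Var 0]; it is not lost, since every term
    recurs at large indices. *)
Definition fresh_term_enum l N (i : nat) : term (pvsym l) :=
  if tbound (term_enum l i) <= N + i then term_enum l i else Var 0.

Lemma fresh_term_enum_vars l N i : 0 < N -> tvars_lt (N + i) (fresh_term_enum l N i).
Proof.
rewrite /fresh_term_enum; case: ifP => [le_t _|_ ? /=]; last by rewrite addn_gt0; apply/orP; left.
exact: tvars_lt_le le_t (tvars_lt_tbound _).
Qed.

Lemma fresh_term_enum_surj l N (t : term (pvsym l)) :
  exists i, fresh_term_enum l N i = t.
Proof.
have [i le_ti eq_t] := term_enum_surj t (tbound t).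
by exists i; rewrite /fresh_term_enum eq_t (leq_trans le_ti (leq_addl _ _)).
Qed.

(** * Named quantifiers *)

Lemma tvars_lt_tsubst F M N (s : nat -> term F) t :
  tvars_lt M t -> (forall i, i < M -> tvars_lt N (s i)) -> tvars_lt N (tsubst s t).
Proof.
elim: t => [i|n f a IH] /= ht hs; first exact: hs.
by move=> i; apply: IH.
Qed.

Lemma fvars_lt_fsubst F M N (s : nat -> term F) A :
  fvars_lt M A -> (forall i, i < M -> tvars_lt N (s i)) -> fvars_lt N (fsubst s A).
Proof.
elim: A M N s => [|t u|t u|A IHA B IHB|A IHA] M N s //=.
- by case=> ht hu hs; split; apply: tvars_lt_tsubst hs.
- by case=> ht hu hs; split; apply: tvars_lt_tsubst hs.
- by case=> hA hB hs; split; [apply: IHA hs | apply: IHB hs].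
- move=> hA hs; apply: IHA hA _ => -[//|i] /= /hs hi.
  by apply: tvars_lt_tsubst hi _ => j.
Qed.

Lemma fvars_lt_allv F x (A : form F) : fvars_lt x.+1 A -> fvars_lt x (allv x A).
Proof.
move=> hA; apply: fvars_lt_fsubst hA _ => i; rewrite ltnS leq_eqVlt.
by case: eqP.
Qed.

Lemma qf_fsubst F (s : nat -> term F) A : qf A -> qf (fsubst s A).
Proof. by elim: A s => //= A IHA B IHB s [/IHA ? /IHB]. Qed.

Definition fresh F x (A : form F) : Prop :=
  forall s s', (forall i, i != x -> s i = s' i) -> fsubst s A = fsubst s' A.

Lemma fresh_lt F N x (A : form F) : fvars_lt N A -> N <= x -> fresh x A.
Proof.
move=> hA le_Nx s s' hs; apply: fsubst_ext_lt hA _ => i lt_iN; apply: hs.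
by rewrite neq_ltn (leq_trans lt_iN).
Qed.

Lemma fresh_le F x y (t : term F) :
  x != y -> tvars_lt x t -> fresh x (Var y <=f t).
Proof.
move=> ne_xy ht s s' hs /=; rewrite hs 1?eq_sym //; congr Le.
by apply: tsubst_ext_lt ht _ => i lt_ix; apply: hs; rewrite neq_ltn lt_ix.
Qed.

(** The substitution that binds [x] shifts all other variables, so on hypotheses where [x] is fresh
    it agrees with the shift demanded by [prv_allI]. This is why [fresh] is phrased through
    substitutions. *)
Lemma prv_allvI F (T : form F -> Prop) G x A :
  (forall B, List.In B G -> fresh x B) -> prv T G A -> prv T G (allv x A).
Proof.
move=> hG /(prv_fsubst (fun i => if i == x then Var 0 else Var i.+1)) pA.
apply: prv_allI; move: pA; congr prv; apply: List.map_ext_in => B /hG hB.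
by apply: hB => i /negbTE ->.
Qed.

Lemma prv_allvE F (T : form F -> Prop) G x A t :
  prv T G (allv x A) -> prv T G (fsub1 A x t).
Proof. by rewrite -inst_bind; apply: prv_allE. Qed.

Lemma prv_all_leI F (T : form F -> Prop) G x t A :
  (forall B, List.In B G -> fresh x B) -> prv T ((Var x <=f t) :: G) A ->
  prv T G (all_le x t A).
Proof. by move=> hG pA; apply: prv_allvI => //; apply: prv_impI. Qed.

Lemma prv_all_leE F (T : form F -> Prop) G x t A :
  prv T G (all_le x t A) -> prv T ((Var x <=f t) :: G) A.
Proof. by move=> /(prv_allvE (Var x)); rewrite fsub1_id; apply: prv_impD. Qed.

Definition bounds F x n (t : term F) : seq (form F) :=
  [seq (Var j <=f t) | j <- iota x n].

Lemma in_bounds F x n (t : term F) B :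
  List.In B (bounds x n t) -> exists2 j, x <= j < x + n & B = (Var j <=f t).
Proof.
elim: n x => [//|n IH] x [<-|/IH [j /andP [le_xj lt_jn] ->]].
  by exists x => //; rewrite leqnn -addSnnS leq_addr.
by exists j => //; rewrite (ltnW le_xj) -addSnnS.
Qed.

Lemma bounds_in F x n (t : term F) j :
  x <= j < x + n -> List.In (Var j <=f t) (bounds x n t).
Proof.
elim: n x => [|n IH] x; first by rewrite addn0 ltnNge andbN.
rewrite -addSnnS => /andP [le_xj lt_jn]; have [->|ne_xj] := eqVneq x j; first by left.
by right; apply: IH; rewrite lt_jn ltn_neqAle ne_xj le_xj.
Qed.

Lemma prv_alls_leI F (T : form F -> Prop) G x n t A :
  tvars_lt x t -> (forall B j, List.In B G -> x <= j -> fresh j B) ->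
  prv T (bounds x n t ++ G) A -> prv T G (alls_le x n t A).
Proof.
elim: n x G => [//|n IH] x G ht hG pA /=.
apply: prv_all_leI => [B hB|]; first by apply: hG hB _.
apply: IH; first exact: tvars_lt_le ht.
  move=> B j [<-|hB] le_xj; last by apply: hG hB (ltnW le_xj).
  by apply: fresh_lt le_xj; split=> /=; last exact: tvars_lt_le ht.
apply: prv_weaken pA => B /= [<-|hB].
  by apply: List.in_or_app; right; left.
case: (List.in_app_or _ _ _ hB) => hB'; apply: List.in_or_app; first by left.
by right; right.
Qed.

Lemma prv_alls_leE F (T : form F -> Prop) G x n t A :
  prv T G (alls_le x n t A) -> prv T (bounds x n t ++ G) A.
Proof.
elim: n x G => [//|n IH] x G /= /prv_all_leE /IH; apply: prv_weaken => B hB.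
case: (List.in_app_or _ _ _ hB) => [hB'|[->|hB']]; [right|by left|right];
  apply: List.in_or_app; by [left|right].
Qed.

(** Turns the provability clauses of [reduction] into sequents with y and the w_j free. The
    innermost quantifier binds the smallest index [p], whose freshness in the bounds on the w_j
    needs [fresh_le]. *)
Lemma prv_quantP F (T : form F -> Prop) p n s t (A : form F) :
  tvars_lt p s -> tvars_lt p t ->
  prv T [::] (alls_le p.+1 n s (all_le p t A)) <->
  prv T ((Var p <=f t) :: bounds p.+1 n s) A.
Proof.
move=> hs ht; split=> [/prv_alls_leE|pA].
  by rewrite cats0; apply: prv_all_leE.
apply: prv_alls_leI => //; first exact: tvars_lt_le hs.
rewrite cats0; apply: prv_all_leI pA => B /in_bounds [j /andP [lt_pj _] ->].
by apply: fresh_le => //; rewrite neq_ltn lt_pj.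
Qed.

(** * Definition by cases in PV *)

Section PV.
Variable l : nat.
Local Notation T := (@pv_ax l).
Implicit Types (G : seq (form (pvsym l))) (t u v c : term (pvsym l)).

Lemma pv_le0 G t : prv T G (tO l <=f t).
Proof. by apply/prv_ax/pv_basic/basic3. Qed.

Lemma pv_1neq0 G : prv T G (tS (tO l) <>f tO l).
Proof.
apply: prv_impI; apply: (prv_impE (A := tO l =f tS (tO l))).
  by apply/prv_ax/pv_basic/basic2.
by apply/prv_sym/prv_hd.
Qed.

Lemma pv_le_refl G t : prv T G (t <=f t).
Proof.
apply: (prv_cases (A := t <=f t)); first exact: prv_hd.
apply: prv_impE (prv_hd _ _ _); apply/prv_ax/pv_basic/basic6.
Qed.

Lemma pv_cond0 G c u v : prv T G (c =f tO l) -> prv T G (tcond c u v =f u).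
Proof. by apply: prv_impE; apply/prv_ax/pv_def/def_cond0. Qed.

Lemma pv_cond1 G c u v : prv T G (c <>f tO l) -> prv T G (tcond c u v =f v).
Proof. by apply: prv_impE; apply/prv_ax/pv_def/def_cond1. Qed.

Lemma pv_neq0 G u v : prv T G (u =f v) -> prv T G (v <>f tO l) -> prv T G (u <>f tO l).
Proof.
move=> uv v0; apply: prv_impI; apply: prv_impE (prv_weaken1 _ v0) _.
exact: prv_trans (prv_sym (prv_weaken1 _ uv)) (prv_hd _ _ _).
Qed.

Lemma pv_cle1 G u v : prv T G (u <=f v) -> prv T G (tcle u v <>f tO l).
Proof.
move=> uv; apply: pv_neq0 (pv_1neq0 _); apply: prv_impE uv.
exact/prv_ax/pv_def/def_cle1.
Qed.

Lemma pv_cle0 G u v : prv T G (Not (u <=f v)) -> prv T G (tcle u v =f tO l).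
Proof. by apply: prv_impE; apply/prv_ax/pv_def/def_cle0. Qed.

(* The value of [tchar A] is 0 exactly when A holds. *)
Fixpoint tchar (A : form (pvsym l)) : term (pvsym l) :=
  match A with
  | Bot => tS (tO l)
  | Eq t u => tcond (tcle t u) (tS (tO l)) (tcond (tcle u t) (tS (tO l)) (tO l))
  | Le t u => tcond (tcle t u) (tS (tO l)) (tO l)
  | Imp B C => tcond (tchar B) (tchar C) (tO l)
  | All _ => tO l
  end.

(** The two halves are proved together: an implication is evaluated by cases on its antecedent,
    using the first half if that holds and the second if it fails. For equations, the second half
    rests on antisymmetry of the order. *)
Lemma tchar_spec A : qf A ->
  (forall G, prv T G A -> prv T G (tchar A =f tO l)) /\
  (forall G, prv T G (Not A) -> prv T G (tchar A <>f tO l)).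
Proof.
elim: A => [|t u|t u|A IHA B IHB|//] /=.
- by move=> _; split=> G pA; [apply: prv_botE | apply: pv_1neq0].
- move=> _; split=> G pA.
    have tu : prv T G (t <=f u) by apply: prv_le_eq pA (pv_le_refl _ _).
    have ut : prv T G (u <=f t) by apply: prv_le_eq (prv_sym pA) (pv_le_refl _ _).
    exact: prv_trans (pv_cond1 _ _ (pv_cle1 tu)) (pv_cond1 _ _ (pv_cle1 ut)).
  apply: (prv_cases (A := t <=f u)); last first.
    by apply: pv_neq0 (pv_1neq0 _); apply/pv_cond0/pv_cle0/prv_hd.
  apply: (pv_neq0 (pv_cond1 _ _ (pv_cle1 (prv_hd _ _ _)))).
  apply: (prv_cases (A := u <=f t)); last first.
    by apply: pv_neq0 (pv_1neq0 _); apply/pv_cond0/pv_cle0/prv_hd.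
  apply: prv_botE; apply: (prv_impE (A := t =f u)).
    by do 2 apply: prv_weaken1.
  apply: (prv_impE (A := t <=f u &f u <=f t)); first by apply/prv_ax/pv_basic/basic7.
  by apply: prv_andI (prv_hd _ _ _); apply: prv_weaken1 (prv_hd _ _ _).
- move=> _; split=> G pA; first exact: pv_cond1 (pv_cle1 pA).
  by apply: pv_neq0 (pv_1neq0 _); apply/pv_cond0/pv_cle0.
- move=> [/IHA {IHA} [A1 A0] /IHB {IHB} [B1 B0]]; split=> G pAB.
    apply: (prv_cases (A := A)); last by apply/pv_cond1/A0/prv_hd.
    apply: prv_trans (pv_cond0 _ _ (A1 _ (prv_hd _ _ _))) _.
    exact/B1/prv_impD.
  have pA : prv T G A.
    apply: prv_raa; apply: prv_impE (prv_weaken1 _ pAB) _; apply: prv_impI.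
    apply: prv_botE; apply: prv_impE (prv_hd _ _ _).
    by apply: prv_weaken1; apply: prv_hd.
  apply: pv_neq0 (pv_cond0 _ _ (A1 _ pA)) _; apply: B0; apply: prv_impI.
  by apply: prv_impE (prv_weaken1 _ pAB) _; apply/prv_impI/prv_weaken1/prv_hd.
Qed.

Lemma tcond_vars N c u v :
  tvars_lt N c -> tvars_lt N u -> tvars_lt N v -> tvars_lt N (tcond c u v).
Proof. by move=> hc hu hv /= [[|[|[|i]]] hi]. Qed.

Lemma tcle_vars N u v : tvars_lt N u -> tvars_lt N v -> tvars_lt N (tcle u v).
Proof. by move=> hu hv /= [[|[|i]] hi]. Qed.

Lemma tO_vars N : tvars_lt N (tO l).
Proof. by case. Qed.

Lemma t1_vars N : tvars_lt N (tS (tO l)).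
Proof. by case=> [[|i] hi] //; apply: tO_vars. Qed.

Lemma tchar_vars N A : fvars_lt N A -> tvars_lt N (tchar A).
Proof.
elim: A => [|t u|t u|A IHA B IHB|A _] /=.
- by move=> _; apply: t1_vars.
- case=> ht hu; apply: tcond_vars (t1_vars N) _; first exact: tcle_vars.
  by apply: tcond_vars (t1_vars N) (tO_vars N); apply: tcle_vars.
- by case=> ht hu; apply: tcond_vars (t1_vars N) (tO_vars N); apply: tcle_vars.
- by case=> /IHA hA /IHB hB; apply: tcond_vars (tO_vars N).
- by move=> _; apply: tO_vars.
Qed.

(** A reduction must provably make legal moves even where the candidate [u] exceeds the bound; 0 is
    a move that is always legal. *)
Definition restrict_le t u : term (pvsym l) := tcond (tcle u t) (tO l) u.

Lemma restrict_leE G t u : prv T G (u <=f t) -> prv T G (restrict_le t u =f u).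
Proof. by move=> ut; apply/pv_cond1/pv_cle1. Qed.

Lemma restrict_le_le G t u : prv T G (restrict_le t u <=f t).
Proof.
apply: (prv_cases (A := u <=f t)).
  exact: prv_le_eq (restrict_leE (prv_hd _ _ _)) (prv_hd _ _ _).
apply: prv_le_eq (pv_le0 _ _); apply/pv_cond0/pv_cle0/prv_hd.
Qed.

Lemma prv_upd_eq G s x A u v :
  prv T G (u =f v) -> prv T G (fsubst (upd s x u) A) -> prv T G (fsubst (upd s x v) A).
Proof.
(* The template has index 0 at [x] and all other values shifted, so updating at [x] becomes
   instantiation of index 0. *)
have updE w : fsubst (upd s x w) A =
    fsubst (scons w Var) (fsubst (upd (fun i => tshift (s i)) x (Var 0)) A).
  rewrite fsubst_comp; congr fsubst; apply: functional_extensionality => i.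
  rewrite /upd; case: eqP => // _.
  by rewrite /tshift tsubst_comp tsubst_Var.
by rewrite !updE; apply: prv_fsubst_eq.
Qed.

(* The first u in r with u <= t and A[x := u] false, or 0. *)
Fixpoint counterexample (s : nat -> term (pvsym l)) x A t r : term (pvsym l) :=
  if r is u :: r' then
    tcond (tchar ((u <=f t) &f Not (fsubst (upd s x u) A))) u
      (counterexample s x A t r')
  else tO l.

Lemma counterexample_le s x A t r G :
  qf A -> prv T G (counterexample s x A t r <=f t).
Proof.
move=> qfA; elim: r => [|u r IH] /=; first exact: pv_le0.
pose B := (u <=f t) &f Not (fsubst (upd s x u) A).
have qfB : qf B by have := qf_fsubst (upd s x u) qfA; rewrite /=; tauto.
have [B1 B0] := tchar_spec qfB.
apply: (prv_cases (A := B)).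
  exact: prv_le_eq (pv_cond0 _ _ (B1 _ (prv_hd _ _ _))) (prv_andEl (prv_hd _ _ _)).
exact: prv_le_eq (pv_cond1 _ _ (B0 _ (prv_hd _ _ _))) (prv_weaken1 _ IH).
Qed.

(** If some candidate in [r] failed, the selected term would equal the first failing one, contrary
    to [A] holding at the selected term. *)
Lemma counterexample_spec s x A t r u G :
  qf A -> List.In u r -> prv T G (fsubst (upd s x (counterexample s x A t r)) A) ->
  prv T G (u <=f t ->f fsubst (upd s x u) A).
Proof.
move=> qfA; elim: r G => [//|v r IH] G /= hu.
pose B := (v <=f t) &f Not (fsubst (upd s x v) A).
have qfB : qf B by have := qf_fsubst (upd s x v) qfA; rewrite /=; tauto.
have [B1 B0] := tchar_spec qfB.
move=> pA; apply: (prv_cases (A := B)).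
  apply: prv_botE; apply: prv_impE (prv_andEr (prv_hd _ _ _)) _.
  exact: prv_upd_eq (pv_cond0 _ _ (B1 _ (prv_hd _ _ _))) (prv_weaken1 _ pA).
case: hu => [<-|hu]; last first.
  by apply: IH hu _; apply: prv_upd_eq (pv_cond1 _ _ (B0 _ (prv_hd _ _ _))) (prv_weaken1 _ pA).
apply: prv_impI; apply: prv_raa; apply: (prv_impE (A := B)).
  by apply: prv_hyp; right; right; left.
by apply: prv_andI; apply: prv_hyp; [right; left | left].
Qed.

Lemma counterexample_vars s x A t r N :
  (forall u, List.In u r -> fvars_lt N (u <=f t)) ->
  (forall u, List.In u r -> fvars_lt N (fsubst (upd s x u) A)) ->
  tvars_lt N (counterexample s x A t r).
Proof.
elim: r => [|u r IH] ht hA /=; first exact: tO_vars.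
have [hu ht'] := ht u (or_introl erefl).
apply: tcond_vars; [|by []|by apply: IH => v hv; [apply: ht|apply: hA]; right].
apply: (tchar_vars (A := (u <=f t) &f Not (fsubst (upd s x u) A))).
by have := hA u (or_introl erefl); rewrite /=; tauto.
Qed.

End PV.

(** * Games *)

Lemma fvars_lt_first_player_wins k p (G : game k p) :
  fvars_lt p (first_player_wins G).
Proof.
have ht N : p <= N -> tvars_lt N (gbound G).
  by move=> /tvars_lt_le; apply; apply: gbound_vars.
have hin : fvars_lt p.+1 (all_le p.+1 (gbound G) (gform G)).
  apply: fvars_lt_allv; split; last exact: gform_vars.
  by split=> //=; apply: ht; apply: leqW.
split=> //; apply: (@fvars_lt_allv _ p (Not ((Var p <=f gbound G) &f
  all_le p.+1 (gbound G) (gform G)))).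
by do !split=> //=; apply: ht.
Qed.

Lemma gplay_fvars_lt k p (G : game k p) N u v :
  p <= N -> tvars_lt N u -> tvars_lt N v -> fvars_lt N (gplay G u v).
Proof.
move=> le_pN hu hv; apply: fvars_lt_fsubst (gform_vars G) _ => i.
rewrite /upd; case: eqP => // /eqP ne1; case: eqP => // /eqP ne0.
rewrite ltnS leq_eqVlt (negbTE ne1) /= ltnS leq_eqVlt (negbTE ne0) /=.
by move=> lt_ip; apply: leq_trans le_pN.
Qed.

Lemma prv_gplay_eq k p (G : game k p) C u u' v :
  prv (@pv_ax k.-1) C (u =f u') -> prv (@pv_ax k.-1) C (gplay G u v) ->
  prv (@pv_ax k.-1) C (gplay G u' v).
Proof.
(* In [gplay] the update of the second move is outermost; exchanging the two exposes the first move
   to [prv_upd_eq]. *)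
have swap w : upd (upd Var p w) p.+1 v = upd (upd Var p.+1 v) p w.
  apply: functional_extensionality => i; rewrite /upd.
  by case: (eqVneq i p.+1) => // ->; rewrite gtn_eqF.
by rewrite /gplay !swap; apply: prv_upd_eq.
Qed.

(* With the first player's move fixed to u, the second player's move may be
   named by any variable not occurring in u. *)
Lemma fsub1_all_le_gform k p (H : game k p) u w :
  p < w -> tvars_lt w u ->
  fsub1 (all_le p.+1 (gbound H) (gform H)) p u =
  allv w ((Var w <=f gbound H) ->f gplay H u (Var w)).
Proof.
move=> lt_pw hu.
pose r i := if i == p.+1 then Var 0 else tshift (upd Var p u i).
have hbind i : i < p.+2 -> r i =
    tsubst (fun i => if i == w then Var 0 else Var i.+1) (upd (upd Var p u) p.+1 (Var w) i).
  rewrite /r {2}/upd; case: eqP => [_ _ /=|/eqP ne1]; first by rewrite eqxx.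
  rewrite ltnS leq_eqVlt (negbTE ne1) /= ltnS => le_ip.
  rewrite /upd; case: eqP => _; last first.
    by rewrite /= ltn_eqF // (leq_ltn_trans le_ip).
  by apply: tsubst_ext_lt hu _ => j lt_jw; rewrite ltn_eqF.
have hs := gbound_vars H.
transitivity (All (fsubst r ((Var p.+1 <=f gbound H) ->f gform H))).
  exact: (congr1 (@All (LPV k)) (fsubst_bind (up (upd Var p u)) p.+1
    ((Var p.+1 <=f gbound H) ->f gform H))).
congr All; rewrite /bind /= eqxx {1}/r eqxx; congr (Imp (Le _ _) _).
  apply: tsubst_ext_lt hs _ => i lt_ip.
  rewrite /r /upd !ltn_eqF //; [exact: ltn_trans lt_pw| exact: ltnW].
by rewrite /gplay fsubst_comp; apply: fsubst_ext_lt (gform_vars H) hbind.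
Qed.

(** * From reductions to proofs *)

Fixpoint play_ctx k p (H : game k p) (f : nat -> term (LPV k))
    (base : seq (form (LPV k))) (i : nat) : seq (form (LPV k)) :=
  if i is j.+1 then
    [:: Not (gplay H (f j) (Var (p.+1 + j))), (Var (p.+1 + j) <=f gbound H)
      & play_ctx H f base j]
  else base.

Lemma play_ctx_base k p (H : game k p) f base i B :
  List.In B base -> List.In B (play_ctx H f base i).
Proof. by move=> hB; elim: i => //= i IH; right; right. Qed.

Lemma play_ctx_le k p (H : game k p) f base i j :
  j < i -> List.In (Var (p.+1 + j) <=f gbound H) (play_ctx H f base i).
Proof.
elim: i => //= i IH; rewrite ltnS leq_eqVlt => /orP [/eqP ->|/IH ?]; first by right; left.
by right; right.
Qed.

Lemma play_ctx_not k p (H : game k p) f base i j :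
  j < i -> List.In (Not (gplay H (f j) (Var (p.+1 + j)))) (play_ctx H f base i).
Proof.
elim: i => //= i IH; rewrite ltnS leq_eqVlt => /orP [/eqP ->|/IH ?]; first by left.
by right; right.
Qed.

(** As [f j] mentions only the replies before w_j, the position after [i] rounds is free of w_i,
    which can then be the eigenvariable for the next reply. *)
Lemma play_ctx_vars k p (H : game k p) f base i B :
  (forall j, j < i -> tvars_lt (p.+1 + j) (f j)) ->
  (forall C, List.In C base -> fvars_lt p.+1 C) ->
  List.In B (play_ctx H f base i) -> fvars_lt (p.+1 + i) B.
Proof.
move=> hf hbase; elim: i hf => [|i IH] hf; first by rewrite addn0; apply: hbase.
have lt_wi : p.+1 + i < p.+1 + i.+1 by rewrite addnS.
have le_pw : p <= p.+1 + i.+1 by rewrite addSnnS leq_addr.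
case=> [<-|[<-|hB]].
- split=> //; apply: gplay_fvars_lt => //.
  by apply: tvars_lt_le (hf i _) => //; apply: ltnW.
- by split=> //; apply: tvars_lt_le le_pw (gbound_vars H).
- apply: fvars_lt_le (ltnW lt_wi) (IH _ hB) => j lt_ji; apply: hf; exact: ltnW.
Qed.

(** The reply bound in [first_player_wins H] is the variable [p.+1], which is w_0 and occurs in the
    context after the first round; a fresh [w] replaces it as eigenvariable. *)
Lemma prv_first_player_winsI k p (H : game k p) C u w :
  p < w -> tvars_lt w u -> (forall B, List.In B C -> fvars_lt w B) ->
  prv (@pv_ax k.-1) C (u <=f gbound H) ->
  prv (@pv_ax k.-1) ((Var w <=f gbound H) :: C) (gplay H u (Var w)) ->
  prv (@pv_ax k.-1) C (first_player_wins H).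
Proof.
move=> lt_pw hu hC pu pH; apply: (prv_exI (t := u)); rewrite inst_bind.
have pall : prv (@pv_ax k.-1) C
    (fsub1 (all_le p.+1 (gbound H) (gform H)) p u).
  rewrite (fsub1_all_le_gform H lt_pw hu).
  apply: prv_allvI; last exact: prv_impI.
  by move=> B /hC /fresh_lt; apply.
apply: prv_andI pall.
rewrite /= {1}/upd eqxx (tsubst_id_lt (gbound_vars H)) // => i lt_ip.
by rewrite /upd ltn_eqF.
Qed.

Lemma reduction_prv k p (H G : game k p) m (f : 'I_m.+1 -> term (LPV k)) g :
  reduction H G f g ->
  PV_proves (Imp (first_player_wins G) (first_player_wins H)).
Proof.
rewrite /reduction /PV_proves addn0 => -[[hf hg] pf pg pred].
have hs := gbound_vars H; have ht := gbound_vars G.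
pose C0 := (Var p <=f gbound G) :: bounds p.+1 m.+1 (gbound H).
have {}pf i : prv (@pv_ax k.-1) C0 (f i <=f gbound H) by apply/prv_quantP.
have {}pg : prv (@pv_ax k.-1) C0 (g <=f gbound G) by apply/prv_quantP.
move/(prv_quantP _ _ _ hs ht): pred => pred.
pose allz := all_le p.+1 (gbound G) (gform G).
have allz_vars : fvars_lt p.+1 allz.
  apply: fvars_lt_allv; split; last exact: gform_vars.
  by split=> //=; apply: tvars_lt_le ht; apply: leqW.
pose base := [:: Var p <=f gbound G; allz; Not (first_player_wins H)].
have base_vars B : List.In B base -> fvars_lt p.+1 B.
  case=> [<-|[<- //|[<-|//]]]; first by split=> //=; apply: tvars_lt_le ht.
  by split=> //; apply: fvars_lt_le (fvars_lt_first_player_wins H).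
pose F j := f (inord j).
have F_vars j : j <= m -> tvars_lt (p.+1 + j) (F j).
  by move=> le_jm; have := hf (inord j); rewrite inordK.
have base_bot : prv (@pv_ax k.-1) base Bot.
  suff all_bot i : i <= m.+1 -> prv (@pv_ax k.-1) (play_ctx H F base i) Bot.
    exact: (all_bot 0).
  (* Backward induction from the complete play of [m.+1] rounds to the empty one; [d] counts the
     rounds taken back. *)
  move=> le_im; rewrite -(subKn le_im).
  elim: (m.+1 - i) (leq_subr i m.+1) => {i le_im} [_|d IH lt_dm].
    rewrite subn0.
    have subC0 B : List.In B C0 -> prv (@pv_ax k.-1) (play_ctx H F base m.+1) B.
      move=> hB; apply: prv_hyp; case: hB => [<-|].
        by apply: play_ctx_base; left.
      move=> /(@in_bounds _ p.+1 m.+1) [j /andP [le_pj lt_jm] ->].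
      by rewrite -(subnKC le_pj); apply: play_ctx_le; rewrite ltn_subLR.
    apply: prv_bigorE (prv_impE (prv_cut subC0 pred) _).
      move=> i; apply: prv_hyp.
      have := @play_ctx_not _ _ H F base m.+1 i (ltn_ord i).
      by rewrite /F inord_val.
    have pallz : prv (@pv_ax k.-1) (play_ctx H F base m.+1) allz.
      by apply: prv_hyp; apply: play_ctx_base; right; left.
    (* The move y beats every legal z, in particular [g]; this is the premise of the reduction
       clause, whose disjuncts are all negated in the context. *)
    have := prv_allvE g pallz; rewrite /fsub1 /= {1}/upd eqxx.
    rewrite (tsubst_id_lt ht) => [|i lt_ip]; last by rewrite /upd ltn_eqF // ltnW.
    move=> /prv_impE /(_ (prv_cut subC0 pg)); congr prv.
    rewrite /gplay; congr fsubst; apply: functional_extensionality => i.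
    by rewrite /upd; case: eqP => // _; case: eqP => // ->.
  have eq_i : m.+1 - d = (m.+1 - d.+1).+1 by rewrite subnSK.
  move/(_ (ltnW lt_dm)): IH; rewrite eq_i; move: (m.+1 - d.+1) eq_i => i eq_i.
  have le_im : i <= m by rewrite -ltnS -eq_i leq_subr.
  move=> /= IH; set C := play_ctx H F base i.
  have C_vars B : List.In B C -> fvars_lt (p.+1 + i) B.
    apply: play_ctx_vars => // j lt_ji; apply: F_vars.
    exact: ltnW (leq_trans lt_ji le_im).
  (* The move [F i] would win [H], because a reply w_i refuting it leads to [Bot] by the induction
     hypothesis; but [base] denies that [H] is won. *)
  apply: (prv_impE (A := first_player_wins H)).
    by apply: prv_hyp; apply: play_ctx_base; right; right; left.
  apply: (prv_first_player_winsI (u := F i) (w := p.+1 + i)) => //.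
  - by rewrite addSn ltnS leq_addr.
  - exact: F_vars.
  - (* The later moves w_j do not occur in f_i; replace them by 0. *)
    pose r j : term (LPV k) := if j < p.+1 + i then Var j else tO k.-1.
    have rt t : tvars_lt p t -> tsubst r t = t.
      move=> hp; apply: (tsubst_id_lt hp) => j lt_jp.
      by rewrite /r ltn_addr // ltnW.
    have <- : fsubst r (F i <=f gbound H) = (F i <=f gbound H).
      rewrite /= (rt _ hs) (tsubst_id_lt (F_vars _ le_im)) //.
      by move=> j; rewrite /r => ->.
    apply: prv_cut (prv_fsubst r (pf (inord i))) => B' hB'.
    have [B [<- hB]] := proj1 (List.in_map_iff (fsubst r) C0 B') hB'.
    case: hB => [<-|] /=.
      rewrite (rt _ ht) /r ltn_addr //; apply: prv_hyp.
      by apply: play_ctx_base; left.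
    move=> /(@in_bounds _ p.+1 m.+1) [j /andP [le_pj lt_jm] ->] /=.
    rewrite (rt _ hs) /r; case: ltnP => [lt_ji|_]; last exact: pv_le0.
    apply: prv_hyp; rewrite -(subnKC le_pj); apply: play_ctx_le.
    by rewrite ltn_subLR.
  - exact: prv_raa.
apply: prv_impI; apply: prv_raa.
(* [first_player_wins G] is a negated universal statement, and y is not free in the two hypotheses
   left, so [base_bot] can be generalized over y. *)
apply: (prv_impE (A := allv p (Not ((Var p <=f gbound G) &f allz)))).
  by apply: prv_hyp; right; left.
apply: prv_allvI.
  move=> B [<-|[<-|//]]; apply: (fresh_lt (N := p)) => //; last first.
    exact: fvars_lt_first_player_wins.
  by split=> //; apply: fvars_lt_first_player_wins.
apply: prv_impI; apply: prv_cut base_bot => B [<-|[<-|[<-|//]]].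
- exact: prv_andEl (prv_hd _ _ _).
- exact: prv_andEr (prv_hd _ _ _).
- by apply: prv_hyp; right; left.
Qed.

(** * From proofs to reductions *)

(* The i-th group of formulas says that the candidate u_i, used as a move of
   the second player in G and of the first player in H, is refuted. *)
Definition refutation k p (H G : game k p) (u : nat -> term (LPV k)) (i : nat) :
    seq (form (LPV k)) :=
  [:: Var (p.+1 + i) <=f gbound H;
      (u i <=f gbound G) ->f gplay G (Var p) (u i);
      (u i <=f gbound H) ->f Not (gplay H (u i) (Var (p.+1 + i)))].

(** Variables denote themselves in the term model. There y wins [G], since each legal answer is some
    [u i]; a winning move in [H] would also be some [u i], and the reply w_i defeats it. *)
Lemma refutations_inconsistent k p (H G : game k p) (u : nat -> term (LPV k)) :
  (forall t, exists i, u i = t) ->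
  PV_proves (Imp (first_player_wins G) (first_player_wins H)) ->
  derives (@pv_ax k.-1)
    (fun B => B = (Var p <=f gbound G) \/ exists i, List.In B (refutation H G u i)) Bot.
Proof.
move=> u_surj pGH; set D := (fun B : form _ => _ \/ _).
have hs v v' : tsubst (upd (upd Var p v) p.+1 v') (gbound H) = gbound H.
  apply: (tsubst_id_lt (gbound_vars H)) => i lt_ip.
  by rewrite /upd !ltn_eqF // ltnW.
have ht v v' : tsubst (upd (upd Var p v) p.+1 v') (gbound G) = gbound G.
  apply: (tsubst_id_lt (gbound_vars G)) => i lt_ip.
  by rewrite /upd !ltn_eqF // ltnW.
have hs1 v : tsubst (upd Var p v) (gbound H) = gbound H.
  by apply: (tsubst_id_lt (gbound_vars H)) => i lt_ip; rewrite /upd ltn_eqF.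
have ht1 v : tsubst (upd Var p v) (gbound G) = gbound G.
  by apply: (tsubst_id_lt (gbound_vars G)) => i lt_ip; rewrite /upd ltn_eqF.
have fGH : forces (@pv_ax k.-1) D Var (first_player_wins G) ->
    forces (@pv_ax k.-1) D Var (first_player_wins H).
  have fImp := forces_sound (@pv_ax_qf k.-1) pGH.
  by apply: (fImp D Var).
apply: forces_ex_leE (fGH _).
  move=> D' v sDD'; rewrite hs1 => dv /forces_all_le fH.
  have [i eq_v] := u_surj v.
  have inD B : List.In B (refutation H G u i) -> derives (@pv_ax k.-1) D' B.
    by move=> hB; apply: derives_ax; apply: sDD'; right; exists i.
  have dN : derives (@pv_ax k.-1) D' (Not (gplay H v (Var (p.+1 + i)))).
    apply: derives_impE dv; rewrite -eq_v; apply: inD; right; right; left; done.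
  apply: derives_impE dN _; apply/forces_qf; first exact: gform_qf.
  apply: fH => //; rewrite hs; apply: inD; by left.
apply: (forces_ex_leI (u := Var p)).
  by rewrite ht1; apply: derives_ax; left.
apply/forces_all_le => D' v sDD'; rewrite ht => dv.
apply/forces_qf; first exact: gform_qf.
have [i eq_v] := u_surj v; apply: derives_impE dv; rewrite -eq_v.
by apply: derives_ax; apply: sDD'; right; exists i; right; left.
Qed.

Lemma prv_reduction k p (H G : game k p) :
  PV_proves (Imp (first_player_wins G) (first_player_wins H)) ->
  exists (m : nat) (f : 'I_m.+1 -> term (LPV k)) (g : term (LPV k)),
    reduction H G f g.
Proof.
pose u : nat -> term (LPV k) := fresh_term_enum k.-1 p.+1.
have u_vars i : tvars_lt (p.+1 + i) (u i) by apply: fresh_term_enum_vars.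
move=> /(refutations_inconsistent (u := u) (fresh_term_enum_surj p.+1)) [L hL pBot].
(* Only finitely many refutation groups enter the inconsistency; the largest index among them
   becomes the last round of the reduction. *)
have [m hm] : exists m, forall B, List.In B L -> B = (Var p <=f gbound G) \/
    exists2 i, i <= m & List.In B (refutation H G u i).
  elim: L hL {pBot} => [|B L IH] hL; first by exists 0.
  have [m hm] := IH (fun C hC => hL C (or_intror hC)).
  have [eqB|[i hi]] := hL B (or_introl erefl).
    by exists m => C [<-|/hm //]; left.
  exists (maxn i m) => C [<-|/hm [|[j le_jm hj]]]; [|by left|].
    by right; exists i => //; apply: leq_maxl.
  by right; exists j => //; apply: leq_trans (leq_maxr _ _).
have hs := gbound_vars H; have ht := gbound_vars G.
pose r := [seq u i | i <- iota 0 m.+1].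
pose f (i : 'I_m.+1) : term (LPV k) := restrict_le (gbound H) (u i).
(* [upd Var p (Var p)] is the identity, written so that the instances tested are literally of the
   form [gplay G (Var p) (u i)]. *)
pose g : term (LPV k) :=
  counterexample (upd Var p (Var p)) p.+1 (gform G) (gbound G) r.
have in_r v : List.In v r -> exists2 i, i <= m & v = u i.
  move=> hv; have [i [<- hi]] := proj1 (List.in_map_iff u (iota 0 m.+1) v) hv.
  exists i => //.
  have : i \in iota 0 m.+1.
    by elim: (iota _ _) hi => //= j q IH [->|/IH hq]; rewrite inE ?eqxx ?hq ?orbT.
  by rewrite mem_iota.
have r_vars v : List.In v r -> tvars_lt (p.+1 + m.+1) v.
  move=> /in_r [i le_im ->]; apply: tvars_lt_le (u_vars i).
  by rewrite leq_add2l ltnW.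
exists m, f, g; rewrite /reduction addn0 /PV_proves; split.
- split=> [i|].
    apply: tcond_vars (tO_vars _ _) (u_vars i); apply: tcle_vars (u_vars i) _.
    by apply: tvars_lt_le hs; rewrite addSnnS leq_addr.
  apply: counterexample_vars => v /r_vars hv.
    by split=> //; apply: tvars_lt_le ht; rewrite addSnnS leq_addr.
  by apply: (gplay_fvars_lt G) => //=; rewrite addSnnS ?leq_addr // addnS ltnS leq_addr.
- by move=> i; apply/prv_quantP => //; apply: restrict_le_le.
- by apply/prv_quantP => //; apply: counterexample_le; apply: gform_qf.
(* Assuming that [G] holds at [g] and that all disjuncts fail, every formula of [L] becomes
   derivable, which contradicts [pBot]. *)
- apply/prv_quantP => //; apply: prv_impI; apply: prv_raa.
  apply: prv_cut pBot => B /hm [->|[i le_im hB]].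
    by apply: prv_hyp; right; right; left.
  have lt_im : i < m.+1 by [].
  case: hB => [<-|[<-|[<-|//]]].
  + apply: prv_hyp; do 3 right; apply: bounds_in.
    by rewrite leq_addr ltn_add2l.
  + apply: (counterexample_spec (r := r)); first exact: gform_qf.
      exact: (List.in_map u _ _ (in_iota_lt lt_im)).
    by apply: prv_weaken1; apply: prv_hd.
  + apply: prv_impI; apply: prv_impI.
    apply: (prv_impE (A := \big[@Or _/Bot]_(j < m.+1)
                              gplay H (f j) (Var (p.+1 + j)))).
      by apply: prv_hyp; right; right; left.
    (* Here [u i] is within the bound of [H], so the cut-off move [f i] equals it and the disjunct
       of index [i] follows. *)
    apply: (prv_bigorI (i := Ordinal lt_im)).
    apply: (prv_gplay_eq (u := u i)); last exact: prv_hd.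
    by apply/prv_sym/restrict_leE/prv_weaken1/prv_hd.
Qed.

Theorem theorem5p21 (k : nat) (hk : 2 <= k) (p : nat) (G H : game k p) :
  PV_proves (Imp (first_player_wins G) (first_player_wins H)) <->
  exists (m : nat) (f : 'I_m.+1 -> term (LPV k)) (g : term (LPV k)),
    reduction H G f g.
Proof.
split; first exact: prv_reduction.
by case=> m [f [g]]; apply: reduction_prv.
Qed.
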